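(* Let $G=(V,\sigma,\mu)$ be a fuzzy graph with $n$ vertices. Then $\gamma_s(G)=\gamma_{snR}(G)$ if and only if $G=\overline{K_n}$, that is, $\mu(u,v)=0$ for all distinct $u,v\in V$.
   Context: A fuzzy graph $G=(V,\sigma,\mu)$ consists of a finite nonempty set $V$, a function $\sigma:V\to[0,1]$, and a symmetric function $\mu:V\times V\to[0,1]$ with $\mu(x,x)=0$ and $\mu(x,y)\le \min\{\sigma(x),\sigma(y)\}$ for all $x,y\in V$. An edge is an unordered pair $(u,v)$ of distinct vertices with $\mu(u,v)>0$, and $\mu(u,v)$ is its weight. The strength of a path $x_0,x_1,\ldots,x_m$ (with every $\mu(x_{i-1},x_i)>0$) is $\min_i \mu(x_{i-1},x_i)$, and $CONN_G(u,v)$ is the maximum strength of all $u$–$v$ paths. An edge $(u,v)$ is strong if $\mu(u,v)=CONN_G(u,v)$; then $u,v$ are strong neighbors. $N_s(u)$ is the set of strong neighbors of $u$. Put $\mu_s(u)=\min\{\mu(u,v):v\in N_s(u)\}$, with $\mu_s(u)=0$ if $N_s(u)=\emptyset$. A strong dominating set is a set $D\subseteq V$ such that every vertex of $V\setminus D$ is a strong neighbor of some vertex of $D$; its weight is $W(D)=\sum_{u\in D}\mu_s(u)$, and $\gamma_s(G)$ is the minimum weight of a strong dominating set of $G$. A strong-neighbors Roman dominating function (SNRDF) on $G$ is a function $f:V\to\{0,1,2\}$ such that every $u$ with $f(u)=0$ has some $v\in N_s(u)$ with $f(v)=2$. Its weight is $w(f)=\sum_{u\in V}f(u)\mu_s(u)$,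 and $\gamma_{snR}(G)$ is the minimum weight of an SNRDF on $G$. *)

(* Defs.v *)
From HB Require Import structures.
From mathcomp Require Import all_boot all_order all_algebra.
From mathcomp Require Import boolp classical_sets reals.

Set Implicit Arguments.
Unset Strict Implicit.
Unset Printing Implicit Defensive.

Import Order.TTheory GRing.Theory Num.Theory.
Local Open Scope ring_scope.

Record fuzzyGraph (R : realType) (V : finType) := FuzzyGraph {
  sigma : V -> R;
  mu : V -> V -> R;
  vertex_nonempty : (0 < #|V|)%N;
  sigma_itv : forall x, 0 <= sigma x <= 1;
  mu_itv : forall x y, 0 <= mu x y <= 1;
  mu_sym : forall x y, mu x y = mu y x;
  mu_diag : forall x, mu x x = 0;
  mu_le_sigma : forall x y, mu x y <= Num.min (sigma x) (sigma y)
}.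

Section FuzzyGraphTheory.
Variables (R : realType) (V : finType) (G : fuzzyGraph R V).

Definition edge (u v : V) : bool := (u != v) && (0 < mu G u v).

(* As in path.v, the path x_0, ..., x_m is given by its first vertex x_0 and
   the sequence [:: x_1; ...; x_m]. *)
Definition is_path (u v : V) (p : seq V) : bool :=
  path (fun x y => 0 < mu G x y) u p && (last u p == v).

(* Weights are at most 1, so for m > 0 the neutral element 1 does not affect
   the minimum; it is the value only of the path of length 0. *)
Definition strength (x0 : V) (p : seq V) : R :=
  \big[Num.min/1]_(w <- pairmap (mu G) x0 p) w.

(* The supremum is a maximum as soon as a path exists (see CONN_attained and
   CONN_ub); it is 0 otherwise. *)
Definition CONN (u v : V) : R :=
  sup [set s | exists2 p, is_path u v p & s = strength u p]%classic.

Definition strong_edge (u v : V) : bool :=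
  edge u v && (mu G u v == CONN u v).

Definition Ns (u : V) : {set V} := [set v | strong_edge u v].

(* When Ns u is nonempty the neutral element 1 is irrelevant, since mu <= 1. *)
Definition mu_s (u : V) : R :=
  if Ns u == finset.set0 then 0 else \big[Num.min/1]_(v in Ns u) mu G u v.

Definition strong_dominating (D : {set V}) : bool :=
  [forall u, (u \notin D) ==> [exists v in D, u \in Ns v]].

Definition W (D : {set V}) : R := \sum_(u in D) mu_s u.

(* The initial value W [set: V] is itself the weight of a strong dominating
   set (strong_dominatingT), so this is the minimum over that family. *)
Definition gamma_s : R :=
  \big[Num.min/W [set: V]]_(D : {set V} | strong_dominating D) W D.

Definition SNRDF (f : {ffun V -> 'I_3}) : bool :=
  [forall u, (f u == 0%N :> nat) ==> [exists v in Ns u, f v == 2%N :> nat]].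

Definition snr_weight (f : {ffun V -> 'I_3}) : R :=
  \sum_u (f u)%:R * mu_s u.

Definition const1 : {ffun V -> 'I_3} := [ffun=> inord 1].

(* The initial value is the weight of an SNRDF (SNRDF_const1). *)
Definition gamma_snR : R :=
  \big[Num.min/snr_weight const1]_(f : {ffun V -> 'I_3} | SNRDF f)
    snr_weight f.

Lemma strong_dominatingT : strong_dominating [set: V].
Proof. by apply/forallP => u; rewrite inE. Qed.

Lemma SNRDF_const1 : SNRDF const1.
Proof. by apply/forallP => u; rewrite ffunE inordK. Qed.

Lemma strength_le1 x p : strength x p <= 1.
Proof.
by rewrite /strength; elim: (pairmap _ _ _) => [|w s IH];
  rewrite ?big_nil // big_cons ge_min IH orbT.
Qed.

Lemma strength_values x p :
  strength x p \in 1 :: [seq mu G e.1 e.2 | e : V * V].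
Proof.
rewrite /strength; elim: p x => [|y p IH] x /=.
  by rewrite big_nil mem_head.
rewrite big_cons minEle; case: ifP => _; last exact: IH.
by rewrite inE; apply/orP; right; apply/fintype.imageP; exists (x, y).
Qed.

Lemma CONN_ub u v p : is_path u v p -> strength u p <= CONN u v.
Proof.
move=> hp; apply: ub_le_sup; last by exists p.
by exists 1 => _ [q _ ->]; exact: strength_le1.
Qed.

Lemma CONN_attained u v p :
  is_path u v p -> exists2 q, is_path u v q & CONN u v = strength u q.
Proof.
move=> hp; pose vals := 1 :: [seq mu G e.1 e.2 | e : V * V].
pose P w := `[< exists2 q, is_path u v q & w = strength u q >].
pose good := [seq w <- vals | P w].
have goodP q : is_path u v q -> strength u q \in good.
  move=> hq; rewrite mem_filter strength_values andbT.
  by apply/asboolP; exists q.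
pose i0 := SeqSub (goodP p hp).
have [[m mg] _ mmax] := @arg_maxP _ _ (seq_sub good) i0 xpredT val isT.
have := mg; rewrite mem_filter => /andP[/asboolP[q hq mq] _].
exists q => //; apply/eqP; rewrite eq_le CONN_ub // andbT.
apply: ge_sup; first by exists (strength u p), p.
move=> _ [r hr ->]; rewrite -mq.
exact: (mmax (SeqSub (goodP r hr)) isT).
Qed.

End FuzzyGraphTheory.

(* Main.v *)
(* For an optimal SNRDF f, the set D of vertices with f <> 0 is strong
   dominating, and w(f) - W(D) is the sum of mu_s over the vertices of value 2.
   If that sum vanishes, these vertices have no strong neighbors, so no vertex
   has value 0 and w(f) = W(V).  But an edge of maximal weight is strong, and
   removing one of its ends from V leaves a strong dominating set of weight
   less than W(V). *)
Require Import Defs.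
From HB Require Import structures.
From mathcomp Require Import all_boot all_order all_algebra.
From mathcomp Require Import boolp classical_sets reals.

Set Implicit Arguments.
Unset Strict Implicit.
Unset Printing Implicit Defensive.

Import Order.TTheory GRing.Theory Num.Theory.
Local Open Scope ring_scope.

Section StrongNeighbors.
Variables (R : realType) (V : finType) (G : fuzzyGraph R V).

Lemma mu_ge0 x y : 0 <= mu G x y.
Proof. by have /andP[] := mu_itv G x y. Qed.

(** Comparing strengths becomes a statement about [path], which behaves well under reversal;
    [t <= 1] accounts for the neutral element 1. *)
Lemma le_strength t x p :
  (t <= strength G x p) = (t <= 1) && path (fun a b => t <= mu G a b) x p.
Proof.
rewrite /strength; elim: p x => [|y p IH] x /=; first by rewrite big_nil andbT.
by rewrite big_cons le_min IH andbCA.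
Qed.

(** Two reals with the same lower bounds are equal, so reversing the [path] of [le_strength]
    suffices. The reversal of [x :: p] is [last x p :: rev (belast x p)]. *)
Lemma strength_rev x p :
  strength G (last x p) (rev (belast x p)) = strength G x p.
Proof.
have le_rev t : (t <= strength G (last x p) (rev (belast x p))) =
                (t <= strength G x p).
  rewrite !le_strength rev_path; congr (_ && _).
  by apply: eq_path => a b; rewrite mu_sym.
by apply: le_anti; rewrite -le_rev lexx le_rev lexx.
Qed.

Lemma is_path_rev u v p :
  is_path G u v p -> is_path G v u (rev (belast u p)).
Proof.
move=> /andP[up /eqP<-]; apply/andP; split.
  by rewrite rev_path (eq_path (e' := fun x y => 0 < mu G x y)) // => a b;
    rewrite mu_sym.
by case: p {up} => //= y p; rewrite rev_cons last_rcons.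
Qed.

Lemma CONN_sym u v : CONN G u v = CONN G v u.
Proof.
rewrite /CONN; congr sup; apply/seteqP.
by split=> _ [p hp ->]; (eexists; first exact: is_path_rev hp);
  case/andP: hp => _ /eqP<-; rewrite strength_rev.
Qed.

(** Strong domination looks from the dominating vertex, an SNRDF from the vertex of value 0; this
    passes between the two. *)
Lemma Ns_sym u v : (u \in Ns G v) = (v \in Ns G u).
Proof. by rewrite !inE /strong_edge /edge CONN_sym mu_sym eq_sym. Qed.

(** Strong edges have positive weight, and so does a finite minimum of such weights and 1. *)
Lemma mu_s_gt0 u : (0 < mu_s G u) = (Ns G u != finset.set0).
Proof.
rewrite /mu_s; case: ifP => _; first by rewrite ltxx.
apply: (big_ind (fun x : R => 0 < x)) => [|x y x0 y0|v]; first exact: ltr01.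
  by rewrite lt_min x0.
by rewrite inE => /andP[/andP[]].
Qed.

Lemma mu_s_ge0 u : 0 <= mu_s G u.
Proof.
have [e|] := eqVneq (Ns G u) finset.set0; first by rewrite /mu_s e eqxx.
by rewrite -mu_s_gt0 => /ltW.
Qed.

Lemma max_edge_in_Ns u v :
  0 < mu G u v -> (forall x y, mu G x y <= mu G u v) -> v \in Ns G u.
Proof.
move=> uv_gt0 uv_max.
have uv : u != v by apply: contraTneq uv_gt0 => ->; rewrite mu_diag ltxx.
have uv_path : is_path G u v [:: v] by rewrite /is_path /= uv_gt0 eqxx.
rewrite inE /strong_edge /edge uv uv_gt0 /= eq_le; apply/andP; split.
  apply: le_trans (CONN_ub uv_path).
  by rewrite le_strength /= lexx !andbT; have /andP[] := mu_itv G u v.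
(* A path of length 0 would have strength 1, but [u != v] excludes it; any other path is at most as
   strong as its first edge, hence as the maximal weight. *)
have [[|y p] hp ->] := CONN_attained uv_path.
  by move: hp; rewrite /is_path /= (negPf uv).
by rewrite /strength /= big_cons ge_min uv_max.
Qed.

Lemma exists_strong_neighbor u v :
  0 < mu G u v -> exists x y, y \in Ns G x.
Proof.
move=> uv_gt0.
have [[x y] _ xy_max] :=
  @arg_maxP _ _ (V * V)%type (u, v) xpredT (fun e => mu G e.1 e.2) isT.
exists x, y; apply: max_edge_in_Ns => [|a b]; last exact: (xy_max (a, b)).
exact: lt_le_trans uv_gt0 (xy_max (u, v) isT).
Qed.

Lemma gamma_s_le D : strong_dominating G D -> gamma_s G <= W G D.
Proof. by move=> hD; exact: bigmin_le_cond. Qed.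

(** The minimum of two attained weights is one of them, and the initial value is attained by
    [const1]. *)
Lemma gamma_snR_attained :
  exists2 f, SNRDF G f & gamma_snR G = snr_weight G f.
Proof.
apply: (big_ind (fun x => exists2 f, SNRDF G f & x = snr_weight G f)).
- by exists (const1 V) => //; exact: SNRDF_const1.
- by move=> _ _ [f hf ->] [g hg ->]; rewrite minEle; case: ifP => _;
    [exists f | exists g].
- by move=> f hf; exists f.
Qed.

Lemma strong_dominating_support f :
  SNRDF G f -> strong_dominating G [set u | f u != 0%N :> nat].
Proof.
move=> /forallP hf; apply/forallP => u; apply/implyP; rewrite inE negbK => fu.
have /existsP[v /andP[uv /eqP fv]] := implyP (hf u) fu.
by apply/existsP; exists v; rewrite inE fv Ns_sym.
Qed.

Lemma strong_dominatingD1 u v :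
  v \in Ns G u -> strong_dominating G ([set: V] :\ u).
Proof.
move=> uv; apply/forallP => w; apply/implyP; rewrite !inE andbT negbK => /eqP->.
apply/existsP; exists v; rewrite Ns_sym uv !inE !andbT eq_sym.
by move: uv; rewrite inE => /andP[/andP[]].
Qed.

(** Pointwise, a value in {0,1,2} is the indicator of being nonzero plus the indicator of being
    2. *)
Lemma snr_weightE f :
  snr_weight G f = W G [set u | f u != 0%N :> nat] +
                   W G [set u | f u == 2%N :> nat].
Proof.
rewrite /snr_weight /W [X in _ = X + _]big_mkcond [X in _ = _ + X]big_mkcond.
rewrite -big_split /=; apply: eq_bigr => u _; rewrite !inE.
by case: (f u) => [[|[|[|]]]] //= _; rewrite ?mul0r ?mul1r ?addr0 // mulrDl mul1r.
Qed.

Lemma gamma_s_lt_snR u v : 0 < mu G u v -> gamma_s G < gamma_snR G.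
Proof.
move=> uv_gt0; have [f hf ->] := gamma_snR_attained.
rewrite snr_weightE; set D := [set _ | _ != _]; set D2 := [set _ | _].
have [w /andP[wD2 wNs]|no2] := pickP [pred w in D2 | Ns G w != finset.set0].
  apply: le_lt_trans (gamma_s_le (strong_dominating_support hf)) _.
  rewrite ltrDl /W (bigD1 w) //= ltr_wpDr ?mu_s_gt0 //.
  by apply: sumr_ge0 => ? _; exact: mu_s_ge0.
have DT : D = [set: V].
  apply/setP => x; rewrite !inE; apply/negP => fx.
  (* A vertex [x] of value 0 would be a strong neighbor of some [y] of value 2, against [no2]. *)
  have /existsP[y /andP[xy fy]] := implyP (forallP hf x) fx.
  have /negP[] := negbT (no2 y); rewrite inE /= inE fy.
  by apply/set0Pn; exists x; rewrite Ns_sym.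
have [x [y xy]] := exists_strong_neighbor uv_gt0.
apply: le_lt_trans (gamma_s_le (strong_dominatingD1 xy)) _.
(* Once the sum over the other vertices cancels, [mu_s G x > 0] gives strictness, while [W G D2] is
   nonnegative. *)
rewrite DT {2}/W (big_setD1 x) ?inE //= addrAC ltrDr ltr_wpDr //.
  by apply: sumr_ge0 => ? _; exact: mu_s_ge0.
by rewrite mu_s_gt0; apply/set0Pn; exists y.
Qed.

Lemma mu_s_edgeless u : (forall v, u != v -> mu G u v = 0) -> mu_s G u = 0.
Proof.
move=> mu0; apply: le_anti; rewrite mu_s_ge0 andbT leNgt mu_s_gt0 negbK.
apply/eqP/setP => v; rewrite !inE /strong_edge /edge.
by have [//|uv] := eqVneq u v; rewrite mu0 ?ltxx.
Qed.

End StrongNeighbors.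

Theorem theorem3p4 (R : realType) (V : finType) (n : nat)
    (G : fuzzyGraph R V) (hn : #|V| = n) :
  gamma_s G = gamma_snR G <->
  (forall u v : V, u != v -> mu G u v = 0).
Proof.
split=> [eq_gamma u v _|mu0].
  apply: le_anti; rewrite mu_ge0 andbT leNgt; apply/negP => /gamma_s_lt_snR.
  by rewrite eq_gamma ltxx.
have mu_s0 u : mu_s G u = 0 by apply: mu_s_edgeless => v; exact: mu0.
have W0 D : W G D = 0 by apply: big1 => u _.
(* The initial value and every term of this minimum are values of [W], hence 0. *)
have -> : gamma_s G = 0.
  by apply: (big_ind (fun x => x = 0)) => // _ _ -> ->; rewrite minxx.
by have [f _ ->] := gamma_snR_attained G; rewrite snr_weightE !W0 addr0.
Qed.
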